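(* Let $\mathcal A,\mathcal B$ be unital pro-$C^*$-algebras, $E$ a full Hilbert $\mathcal A$-module, $F$ a Hilbert $\mathcal{BB}$-module, and let $\Phi,\Psi\in\mathcal{CP}(E,F)$ with Stinespring constructions $(\pi_\Phi,K_\phi,K_\Phi,V_\phi,W_\Phi)$ and $(\pi_\Psi,K_\psi,K_\Psi,V_\psi,W_\Psi)$. Then the following are equivalent: (1) $\Phi\sim\Psi$; (2) there exists a partial isometry $V\in\mathcal L_{\mathcal B}(F)$ such that (i) $VV^*=W_\Phi^*W_\Phi$ and $V^*V=W_\Psi^*W_\Psi$, and (ii) $\Phi(x)=V\Psi(x)$ for all $x\in E$.
   Context: A pro-$C^*$-algebra is a complex $*$-algebra that is complete and Hausdorff for the locally convex topology of a family of submultiplicative, $*$-invariant seminorms $p$ with $p(x^*x)=p(x)^2$; $S(\mathcal A)$ is the set of continuous such seminorms on $\mathcal A$. An element is positive if it has the form $b^*b$. A linear map $\phi:\mathcal A\to\mathcal B$ is completely positive if every entrywise map $\phi^{(n)}:M_n(\mathcal A)\to M_n(\mathcal B)$ sends positive elements to positive elements. A Hilbert $\mathcal A$-module is a right $\mathcal A$-module with an $\mathcal A$-valued inner product (linear in the second variable, positive definite), complete for the seminorms $\|\xi\|_p=\sqrt{p(\langle\xi,\xi\rangle)}$, $p\in S(\mathcal A)$; it is full if the closed linear span of all inner products is $\mathcal A$. $\mathcal L_{\mathcal B}(G,H)$ denotes the bounded (for each $p$) adjointable $\mathcal B$-linear maps between Hilbert $\mathcal B$-modules, $\mathcal L_{\mathcal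 B}(G)=\mathcal L_{\mathcal B}(G,G)$. A Hilbert $\mathcal{BB}$-module (two-sided Hilbert $\mathcal B$-module) is a Hilbert $\mathcal B$-module $G$ with a non-degenerate $*$-homomorphism $\tau:\mathcal B\to\mathcal L_{\mathcal B}(G)$; one writes $b\cdot g=\tau(b)g$ and $bI_G=\tau(b)$. $[\,\cdot\,]$ denotes closed linear span. For a linear map $\phi:\mathcal A\to\mathcal B$, a map $\Phi:E\to F$ is a $\phi$-map if $\langle\Phi(x),\Phi(y)\rangle=\phi(\langle x,y\rangle)$ for all $x,y\in E$. $\mathcal{CP}(E,F)$ is the set of maps $\Phi:E\to F$ that are $\phi$-maps for some continuous completely positive $\phi:\mathcal A\to\mathcal B$; since $E$ is full, $\phi$ is determined by $\Phi$, and $\phi,\psi$ denote the maps associated with $\Phi,\Psi$. Write $\Phi\sim\Psi$ if $\langle\Phi(x),\Phi(x)\rangle=\langle\Psi(x),\Psi(x)\rangle$ for all $x\in E$. Stinespring construction: each $\Phi\in\mathcal{CP}(E,F)$ with associated $\phi$ has attached to it $(\pi_\Phi,K_\phi,K_\Phi,V_\phi,W_\Phi)$ together with a two-sided Hilbert $\mathcal B$-module $D$ (the module associated with $\mathcal B\otimes X$, where $X$ is the GNS module with GNS vector $\xi$) and the vector $1_{\mathcal B}\otimes\xi\in D$. Here $K_\phi,K_\Phi$ are Hilbert $\mathcal B$-modules; $\pi_\phi:\mathcal A\to\mathcal L_{\mathcal B}(K_\phi)$ is a unital continuous $*$-representation; $\pi_\Phi:E\to\mathcal L_{\mathcal B}(K_\phi,K_\Phi)$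 satisfies $\pi_\Phi(x)^*\pi_\Phi(y)=\pi_\phi(\langle x,y\rangle)$ and $\pi_\Phi(xa)=\pi_\Phi(x)\pi_\phi(a)$; $V_\phi\in\mathcal L_{\mathcal B}(D,K_\phi)$, and $W_\Phi\in\mathcal L_{\mathcal B}(F,K_\Phi)$ is a co-isometry ($W_\Phi W_\Phi^*=I$); $\phi(a)I_D=V_\phi^*\pi_\phi(a)V_\phi$ for $a\in\mathcal A$; $\Phi(z)=W_\Phi^*\pi_\Phi(z)V_\phi(1_{\mathcal B}\otimes\xi)$ for $z\in E$; and minimality holds: $[\pi_\phi(\mathcal A)V_\phi D]=K_\phi$, $[\pi_\Phi(E)V_\phi D]=K_\Phi$. The same $D$ and $1_{\mathcal B}\otimes\xi$ are used for $\Phi$ and $\Psi$. *)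

(* Defs.v *)
From HB Require Import structures.
From mathcomp Require Import all_boot all_order all_algebra.
From mathcomp Require Import complex.
From mathcomp Require Import boolp classical_sets reals topology normedtype.

Set Implicit Arguments.
Unset Strict Implicit.
Unset Printing Implicit Defensive.

Import Order.TTheory GRing.Theory Num.Theory.
Import numFieldNormedType.Exports.

Local Open Scope classical_set_scope.
Local Open Scope ring_scope.

(* Uniformity of the locally convex topology defined by the seminorms in Q. *)
Definition seminorm_entourage (R : realType) (V : zmodType) (Q : set (V -> R)) :
    set_system (V * V) :=
  smallest (@Filter (V * V)%type)
    [set [set xy : V * V | q (xy.1 - xy.2) < e] |
       q in Q & e in [set e : R | 0 < e]].

(* The library's completeType also carries a distinguished point. *)
Definition complete_space (T : uniformType) : Prop :=
  forall F : set_system T, ProperFilter F -> cauchy F -> exists l : T, F --> l.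

Definition lspan (K : pzRingType) (V : lmodType K) (S : set V) : set V :=
  [set v | exists (n : nat) (c : 'I_n -> K) (s : 'I_n -> V),
     (forall i, S (s i)) /\ v = \sum_(i < n) c i *: s i].

(* algType makes these algebras unital, with 1 != 0. *)
HB.mixin Record isStarAlgebra (R : realType) A of GRing.Algebra R[i] A := {
  star : A -> A;
  starK : involutive star;
  starD : forall a b : A, star (a + b) = star a + star b;
  starZ : forall (c : R[i]) (a : A), star (c *: a) = (conjc c) *: star a;
  starM : forall a b : A, star (a * b) = star b * star a
}.

#[short(type="starAlgType")]
HB.structure Definition StarAlgebra (R : realType) :=
  {A of isStarAlgebra R A & GRing.Algebra R[i] A}.

Definition positive (R : realType) (A : starAlgType R) (a : A) : Prop :=
  exists b : A, a = star b * b.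

Record cstar_seminorm (R : realType) (A : starAlgType R) (p : A -> R) : Prop := {
  csn_ge0 : forall x, 0 <= p x;
  csnD : forall x y, p (x + y) <= p x + p y;
  csnZ : forall (c : R[i]) x, p (c *: x) = ComplexField.Normc.normc c * p x;
  csnM : forall x y, p (x * y) <= p x * p y;
  csn_star : forall x, p (star x) = p x;
  csn_cstar : forall x, p (star x * x) = p x ^+ 2
}.

HB.mixin Record isProCStar (R : realType) A of StarAlgebra R A & Uniform A := {
  procstar_complete : complete_space A;
  procstar_hausdorff : hausdorff_space A;
  procstar_topology : exists Q : set (A -> R),
    (forall p, Q p -> cstar_seminorm p) /\
    entourage = seminorm_entourage Q :> set_system (A * A)
}.

(* Unital pro-C*-algebras. *)
#[short(type="proCStarType")]
HB.structure Definition ProCStar (R : realType) :=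
  {A of isProCStar R A & StarAlgebra R A & Uniform A}.

(* S(A) *)
Definition cont_seminorms (R : realType) (A : proCStarType R) : set (A -> R) :=
  [set p | cstar_seminorm p /\ continuous p].
Arguments cont_seminorms {R} A _.

Definition mxstar (R : realType) (A : starAlgType R) (n : nat) (M : 'M[A]_n) :
  'M[A]_n := \matrix_(i, j) star (M j i).

Definition mxpositive (R : realType) (A : starAlgType R) (n : nat)
    (M : 'M[A]_n) : Prop :=
  exists N : 'M[A]_n, M = mxstar N *m N.

Definition completely_positive (R : realType) (A B : starAlgType R)
    (phi : {linear A -> B}) : Prop :=
  forall (n : nat) (M : 'M[A]_n), mxpositive M -> mxpositive (map_mx phi M).

HB.mixin Record isHilbertModule (R : realType) (A : proCStarType R) E
    of GRing.Lmodule R[i] E & Uniform E := {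
  rmul : E -> A -> E;
  rmulDl : forall (x y : E) (a : A), rmul (x + y) a = rmul x a + rmul y a;
  rmulDr : forall (x : E) (a b : A), rmul x (a + b) = rmul x a + rmul x b;
  rmulM : forall (x : E) (a b : A), rmul x (a * b) = rmul (rmul x a) b;
  rmul1 : forall x : E, rmul x 1 = x;
  rmulZl : forall (c : R[i]) (x : E) (a : A), rmul (c *: x) a = c *: rmul x a;
  rmulZr : forall (c : R[i]) (x : E) (a : A), rmul x (c *: a) = c *: rmul x a;
  inner : E -> E -> A;
  innerDr : forall x y z : E, inner x (y + z) = inner x y + inner x z;
  innerZr : forall (c : R[i]) (x y : E), inner x (c *: y) = c *: inner x y;
  inner_rmul : forall (x y : E) (a : A), inner x (rmul y a) = inner x y * a;
  inner_star : forall x y : E, star (inner x y) = inner y x;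
  inner_ge0 : forall x : E, positive (inner x x);
  inner_eq0 : forall x : E, inner x x = 0 -> x = 0;
  hilbert_complete : complete_space E;
  hilbert_topology : entourage =
    seminorm_entourage [set (fun x : E => Num.sqrt (p (inner x x))) |
      p in cont_seminorms A] :> set_system (E * E)
}.

#[short(type="hilbertModType")]
HB.structure Definition HilbertModule (R : realType) (A : proCStarType R) :=
  {E of isHilbertModule R A E & GRing.Lmodule R[i] E & Uniform E}.

Definition mnorm (R : realType) (A : proCStarType R) (E : hilbertModType A)
  (p : A -> R) (x : E) : R := Num.sqrt (p (inner x x)).

Definition full (R : realType) (A : proCStarType R) (E : hilbertModType A) : Prop :=
  closure (lspan [set inner x y | x in @setT E & y in @setT E]) = setT.

(* L_B(G, H).  The adjoint, which is unique, is carried along as a function. *)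
Record adjointable (R : realType) (B : proCStarType R)
    (G H : hilbertModType B) := Adjointable {
  op :> {linear G -> H};
  adj : H -> G;
  op_rmul : forall (x : G) (b : B), op (rmul x b) = rmul (op x) b;
  op_bounded : forall p : B -> R, cont_seminorms B p ->
    exists M : R, forall x : G, mnorm p (op x) <= M * mnorm p x;
  adjP : forall (x : G) (y : H), inner (op x) y = inner x (adj y)
}.

Record star_rep (R : realType) (A B : proCStarType R) (K : hilbertModType B)
    (pi : A -> adjointable K K) : Prop := {
  star_rep_linear : forall (c : R[i]) (a b : A) (k : K),
    pi (c *: a + b) k = c *: pi a k + pi b k;
  star_rep_mul : forall (a b : A) (k : K), pi (a * b) k = pi a (pi b k);
  star_rep_star : forall (a : A) (k : K), pi (star a) k = adj (pi a) k
}.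

Definition nondegenerate (R : realType) (A B : proCStarType R)
    (K : hilbertModType B) (pi : A -> adjointable K K) : Prop :=
  closure (lspan [set pi a k | a in @setT A & k in @setT K]) = setT.

HB.mixin Record isTwoSided (R : realType) (B : proCStarType R) G
    of HilbertModule R B G := {
  lact : B -> adjointable G G;
  lact_rep : star_rep lact;
  lact_nondegenerate : nondegenerate lact
}.

#[short(type="hilbertBimodType")]
HB.structure Definition HilbertBimodule (R : realType) (B : proCStarType R) :=
  {G of isTwoSided R B G & HilbertModule R B G}.

(* The seminorms T |-> sup {|T x|_p : |x|_p <= 1} define the topology of L_B(G, H). *)
Definition opnorm (R : realType) (B : proCStarType R) (G H : hilbertModType B)
    (p : B -> R) (T : G -> H) : R :=
  sup [set mnorm p (T x) | x in [set x : G | mnorm p x <= 1]].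

Definition rep_continuous (R : realType) (A B : proCStarType R)
    (K : hilbertModType B) (pi : A -> adjointable K K) : Prop :=
  forall p : B -> R, cont_seminorms B p -> forall a : A,
    opnorm p (fun k => pi a' k - pi a k) @[a' --> a] --> (0 : R).

Definition phi_map (R : realType) (A B : proCStarType R) (E : hilbertModType A)
    (F : hilbertModType B) (phi : A -> B) (Phi : E -> F) : Prop :=
  forall x y : E, inner (Phi x) (Phi y) = phi (inner x y).

(* Phi belongs to CP(E, F), with associated map phi. *)
Record cp_map (R : realType) (A B : proCStarType R) (E : hilbertModType A)
    (F : hilbertModType B) (phi : {linear A -> B}) (Phi : E -> F) : Prop := {
  cp_map_continuous : continuous phi;
  cp_map_cp : completely_positive phi;
  cp_map_phi : phi_map phi Phi
}.

Definition equiv_map (R : realType) (A B : proCStarType R)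
    (E : hilbertModType A) (F : hilbertModType B) (Phi Psi : E -> F) : Prop :=
  forall x : E, inner (Phi x) (Phi x) = inner (Psi x) (Psi x).

(* Stinespring constructions of Phi over the two-sided module D; the vector d0
   of D plays the role of 1 (x) xi. *)
Record stinespring (R : realType) (A B : proCStarType R) (E : hilbertModType A)
    (F : hilbertModType B) (D : hilbertBimodType B) (d0 : D)
    (phi : {linear A -> B}) (Phi : E -> F) := Stinespring {
  st_Kphi : hilbertModType B;
  st_KPhi : hilbertModType B;
  st_rep : A -> adjointable st_Kphi st_Kphi;
  st_pi : E -> adjointable st_Kphi st_KPhi;
  st_V : adjointable D st_Kphi;
  st_W : adjointable F st_KPhi;
  st_rep_star : star_rep st_rep;
  st_rep_continuous : rep_continuous st_rep;
  st_rep1 : forall k, st_rep 1 k = k;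
  st_pi_inner : forall (x y : E) (k : st_Kphi),
    adj (st_pi x) (st_pi y k) = st_rep (inner x y) k;
  st_pi_rmul : forall (x : E) (a : A) (k : st_Kphi),
    st_pi (rmul x a) k = st_pi x (st_rep a k);
  st_coisometry : forall k : st_KPhi, st_W (adj st_W k) = k;
  st_phi : forall (a : A) (d : D), lact (phi a) d = adj st_V (st_rep a (st_V d));
  st_Phi : forall z : E, Phi z = adj st_W (st_pi z (st_V d0));
  st_minimal_phi :
    closure (lspan [set st_rep a (st_V d) | a in @setT A & d in @setT D]) = setT;
  st_minimal_Phi :
    closure (lspan [set st_pi x (st_V d) | x in @setT E & d in @setT D]) = setT
}.

Definition partial_isometry (R : realType) (B : proCStarType R)
    (G H : hilbertModType B) (V : adjointable G H) : Prop :=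
  forall x : G, V (adj V (V x)) = V x.

(* Main.v *)
Require Import Defs.
From HB Require Import structures.
From mathcomp Require Import all_boot all_order all_algebra.
From mathcomp Require Import complex.
From mathcomp Require Import boolp classical_sets reals topology normedtype.

Set Implicit Arguments.
Unset Strict Implicit.
Unset Printing Implicit Defensive.

Import Order.TTheory GRing.Theory Num.Theory.
Import numFieldNormedType.Exports.

Local Open Scope classical_set_scope.
Local Open Scope ring_scope.

(** The equivalence rests on the fact that a Stinespring construction is
    determined, up to a unitary, by the completely positive map [phi] over
    which [Phi] lives.

    If [Phi ~ Psi], then [phi] and [psi] agree on all [inner x x], hence by
    polarization on all [inner x y], hence everywhere since [E] is full and
    both maps are continuous ([associated_map_unique]).  Now
      < pi_Phi(x) V_phi d, pi_Phi(y) V_phi e > = < d, phi(<x, y>) e >,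
    so the vectors [pi_Phi(x) V_phi d] and [pi_Psi(x) V_psi d], which have
    dense spans by minimality, have the same inner products.  Matching them
    extends to a unitary [U] from [K_Phi] onto [K_Psi]
    ([stinespring_unitary]), and [V = W_Phi^* U^* W_Psi] is the required
    partial isometry: as [W_Phi] and [W_Psi] are co-isometries,
    [V V^* = W_Phi^* W_Phi], [V^* V = W_Psi^* W_Psi], and
      V Psi(x) = W_Phi^* U^* pi_Psi(x) V_psi d0
               = W_Phi^* pi_Phi(x) V_phi d0 = Phi(x).
    Conversely [Psi(x)] lies in the range of the projection
    [W_Psi^* W_Psi = V^* V], so that applying [V] to it preserves its inner
    square.

    The analytic step is the extension of [U].  It uses that modules are
    complete and that the inner product is continuous in each variable
    ([inner_continuous]).  The usual route to continuity, the Cauchy-Schwarz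
    inequality, relies on the order structure of positive elements.  Here
    continuity comes instead from polarization and from the fact that the
    seminorms define a uniform structure.  The closure of the set of matched
    pairs is then a relation that preserves inner products and is total on
    both sides, which forces it to be the graph of an adjointable bijection
    ([unitary_extension]). *)

(** * Algebra of inner products *)

Lemma starB (R : realType) (A : starAlgType R) (a b : A) :
  star (a - b) = star a - star b.
Proof. by rewrite starD -scaleN1r starZ rmorphN1 scaleN1r. Qed.

Section inner_algebra.
Variables (R : realType) (A : proCStarType R) (E : hilbertModType A).
Implicit Types x y z : E.

Lemma inner_linear x : linear (inner x : E -> A).
Proof. by move=> c y z; rewrite innerDr innerZr. Qed.

HB.instance Definition _ x :=
  GRing.isLinear.Build R[i] E A *:%R (inner x : E -> A) (inner_linear x).

Lemma innerDl x y z : inner (x + y) z = inner x z + inner y z.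
Proof. by rewrite -inner_star innerDr starD !inner_star. Qed.

Lemma innerZl (c : R[i]) x y : inner (c *: x) y = conjc c *: inner x y.
Proof. by rewrite -inner_star innerZr starZ inner_star. Qed.

Lemma innerBl x y z : inner (x - y) z = inner x z - inner y z.
Proof. by rewrite -inner_star linearB starB !inner_star. Qed.

Lemma inner_suml (I : finType) (f : I -> E) y :
  inner (\sum_i f i) y = \sum_i inner (f i) y.
Proof.
apply: (big_morph (fun x => inner x y)); first by move=> u v; exact: innerDl.
by rewrite -(subrr (0 : E)) innerBl subrr.
Qed.

Lemma inner_inj x y : (forall z, inner z x = inner z y) -> x = y.
Proof.
move=> xy; apply/eqP; rewrite -subr_eq0; apply/eqP/inner_eq0.
by rewrite linearB /= xy subrr.
Qed.

Lemma inner_sqr_eq x y :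
  inner x x = inner x y -> inner y x = inner y y -> x = y.
Proof.
move=> xy yx; apply/eqP; rewrite -subr_eq0; apply/eqP/inner_eq0.
by rewrite linearB /= !innerBl xy yx !subrr.
Qed.

Lemma inner_diff x y :
  inner (x + y) (x + y) - inner (x - y) (x - y) =
  2%:R *: (inner x y + inner y x).
Proof.
rewrite !innerBl !innerDl !linearB !linearD /= !opprK.
rewrite [LHS](AC ((2*2)*(2*2)) (((1*5)*(4*8))*((2*6)*(3*7)))) /=.
by rewrite !subrr !add0r -!mulr2n !scaler_nat.
Qed.

Lemma polarization x y :
  4%:R *: inner x y = inner (x + y) (x + y) - inner (x - y) (x - y)
   - 'i%C *: inner (x + 'i%C *: y) (x + 'i%C *: y)
   + 'i%C *: inner (x - 'i%C *: y) (x - 'i%C *: y).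
Proof.
rewrite inner_diff -addrA addrC.
rewrite [- (_ *: _) + _]addrC -scalerBr -opprB scalerN inner_diff.
rewrite innerZl innerZr.
have ii : 'i%C * 'i%C = -1 :> R[i] by rewrite -expr2 sqr_i.
have ci : conjc 'i%C = - 'i%C :> R[i] by rewrite /conjc /=; simpc.
rewrite ci scaleNr -scalerBr !scalerA mulrAC ii mulN1r scaleNr opprK.
rewrite -scalerDr addrACA addNr addr0.
rewrite -[inner x y + _](mulr2n (inner x y)) -[X in 2 *: X]scaler_nat scalerA.
by rewrite -natrM.
Qed.

End inner_algebra.

(** * Topology of Hilbert modules *)

Lemma seminorm_entourage_ball (R : realType) (T : zmodType)
    (Q : set (T -> R)) q (e : R) :
  Q q -> 0 < e -> seminorm_entourage Q [set xy | q (xy.1 - xy.2) < e].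
Proof.
by move=> Qq e0; apply: sub_gen_smallest; exists q => //; exists e.
Qed.

Section cstar_algebra.
Variables (R : realType) (A : proCStarType R).

Lemma csnN (p : A -> R) x : cstar_seminorm p -> p (- x) = p x.
Proof.
by move=> hp; rewrite -scaleN1r (csnZ hp) normcN Normc.normc1 mul1r.
Qed.

(** Any family of seminorms that defines the topology consists of continuous
    seminorms, so convergence can be tested on [cont_seminorms A] alone. *)
Lemma procstar_entourage :
  entourage `<=` seminorm_entourage (cont_seminorms A).
Proof.
have [Q [Qcs EQ]] := @procstar_topology R A.
move=> U; rewrite EQ; apply: smallest_sub.
move=> _ [q Qq [e e0 <-]]; apply: seminorm_entourage_ball => //.
split; first exact: Qcs.
  move=> x; apply/cvgrPdist_lt => d d0.
  have : entourage [set xy : A * A | q (xy.1 - xy.2) < d].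
    by rewrite EQ; exact: seminorm_entourage_ball.
  move=> /(nbhs_entourage x); apply: filterS => y; rewrite /xsection/= inE /=.
  have [hq0 hqD _ _ _ _] := Qcs _ Qq.
  apply: le_lt_trans.
  rewrite ler_norml; apply/andP; split.
    rewrite lerBrDl lerBlDr -(csnN (x - y) (Qcs _ Qq)) opprB addrC.
    by rewrite -{1}(subrK x y) hqD.
  by rewrite lerBlDr -{1}(subrK y x) hqD.
Qed.

End cstar_algebra.

Section hilbert_topology.
Variables (R : realType) (A : proCStarType R) (E : hilbertModType A).

Lemma mnorm_ge0 (p : A -> R) (x : E) : 0 <= mnorm p x.
Proof. exact: sqrtr_ge0. Qed.

Lemma sqr_mnorm (p : A -> R) (x : E) : cstar_seminorm p ->
  mnorm p x ^+ 2 = p (inner x x).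
Proof. by move=> hp; rewrite sqr_sqrtr // csn_ge0. Qed.

Lemma mnormZ (p : A -> R) (c : R[i]) (x : E) : cstar_seminorm p ->
  mnorm p (c *: x) = ComplexField.Normc.normc c * mnorm p x.
Proof.
move=> hp; apply/eqP; rewrite -(@eqrXn2 _ 2) ?mnorm_ge0 //; last first.
  by rewrite mulr_ge0 ?mnorm_ge0 //; case: c => a b; exact: sqrtr_ge0.
rewrite exprMn !sqr_mnorm // innerZl innerZr scalerA (csnZ hp) Normc.normcM.
by rewrite expr2; case: c => a b /=; rewrite sqrrN.
Qed.

Lemma mnormN (p : A -> R) (x : E) : cstar_seminorm p ->
  mnorm p (- x) = mnorm p x.
Proof. by move=> hp; rewrite -scaleN1r mnormZ // normcN Normc.normc1 mul1r. Qed.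

Lemma mnorm_entourage (p : A -> R) (e : R) : cont_seminorms A p -> 0 < e ->
  entourage [set xy : E * E | mnorm p (xy.1 - xy.2) < e].
Proof.
move=> Sp e0; rewrite hilbert_topology.
by apply: (seminorm_entourage_ball (q := mnorm p)) => //; exists p.
Qed.

Lemma hilbert_entourage_sub (P : set_system (E * E)) : Filter P ->
  (forall p e, cont_seminorms A p -> 0 < e ->
    P [set xy : E * E | mnorm p (xy.1 - xy.2) < e]) ->
  entourage `<=` P.
Proof.
move=> FP hP U; rewrite hilbert_topology; apply: smallest_sub.
by move=> _ [_ [p Sp <-] [e e0 <-]]; exact: hP.
Qed.

(** Every neighbourhood of 0 absorbs each vector; this and the next lemma
    supply the two small vectors on which [inner_continuous] uses the
    uniform structure. *)
Lemma entourage_absorb (U : set (E * E)) (z : E) : entourage U ->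
  exists2 d : R, 0 < d & forall s : R, 0 < s -> s < d -> U (s%:C%C *: z, 0).
Proof.
move: U; apply: hilbert_entourage_sub => [|p e Sp e0].
  split; first by exists 1.
    move=> U V [d d0 dU] [d' d'0 dV]; exists (Num.min d d').
      by rewrite lt_min d0.
    move=> s s0; rewrite lt_min => /andP[sd sd'].
    by split; [exact: dU|exact: dV].
  by move=> U V UV [d d0 dU]; exists d => // s s0 sd; apply/UV/dU.
have m1 : 0 < mnorm p z + 1 by rewrite ltr_wpDl ?mnorm_ge0.
exists (e / (mnorm p z + 1)); first exact: divr_gt0.
move=> s s0; rewrite ltr_pdivlMr // => sde /=.
rewrite subr0 mnormZ; last exact: Sp.1.
rewrite /= expr0n addr0 sqrtr_sqr gtr0_norm //.
by apply: le_lt_trans sde; rewrite ler_wpM2l ?ltW // ltrDl.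
Qed.

Lemma entourage_scale_near (U : set (E * E)) (c : R[i]) (y : E) : entourage U ->
  nbhs y [set y' : E | U (0, c *: (y' - y))].
Proof.
move: U; apply: hilbert_entourage_sub => p e Sp e0.
set m := ComplexField.Normc.normc c.
have m0 : 0 <= m by rewrite /m; case: (c) => a b; exact: sqrtr_ge0.
have m1 : 0 < m + 1 by rewrite ltr_wpDl.
have := mnorm_entourage Sp (divr_gt0 e0 m1) => /(nbhs_entourage y).
apply: filterS => y'; rewrite /xsection /= inE /= ltr_pdivlMr // => h.
rewrite sub0r mnormN; last exact: Sp.1.
rewrite mnormZ; last exact: Sp.1.
rewrite -mnormN; last exact: Sp.1.
rewrite opprB -/m mulrC; apply: le_lt_trans h.
by rewrite ler_wpM2l ?mnorm_ge0 // lerDl.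
Qed.

(** By composition of entourages, [mnorm p (a + b)] is small as soon as [a] and
    [b] are close enough to 0, which replaces the triangle inequality.  For
    [s > 0], [inner z (y' - y)] equals [inner (s z) (s^-1 (y' - y))].  Choosing
    first [s] small and then [y'] near [y] makes both arguments small, and
    polarization bounds their inner product by the seminorms of sums. *)
Lemma inner_continuous (z : E) : continuous (inner z : E -> A).
Proof.
move=> y; apply/cvg_entourageP => U /procstar_entourage.
move: U; apply: smallest_sub => _ [p Sp [e e0 <-]].
have hp := Sp.1.
have se0 : 0 < Num.sqrt e by rewrite sqrtr_gt0.
have [B entB BB] := entourage_split_ex (mnorm_entourage Sp se0).
have [d d0 dB] := entourage_absorb z entB.
pose s : R := d / 2.
have s0 : 0 < s by rewrite divr_gt0.
have sd : s < d by rewrite ltr_pdivrMr // ltr_pMr // ltr1n.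
have sC0 : s%:C%C != 0 by rewrite eq_complex /= gt_eqF.
have near_small c := entourage_scale_near (- c * (s%:C%C)^-1) y entB.
have Fy : Filter (nbhs y) := nbhs_filter y.
(* Polarization involves the vectors [s z + c u] for the four units [c]. *)
have near4 := @filterI _ _ Fy _ _
  (@filterI _ _ Fy _ _ (near_small 1) (near_small (- 1)))
  (@filterI _ _ Fy _ _ (near_small 'i%C) (near_small (- 'i%C))).
change (nbhs y [set y' | p (inner z y - inner z y') < e]).
move: near4; apply: filterS => y' [[/= B1 BN1] [/= Bi BNi]].
rewrite /= -(csnN _ hp) opprB -(linearB (inner z)) /=.
set u := s%:C%C^-1 *: (y' - y).
have small c : B (0, (- c * s%:C%C^-1) *: (y' - y)) ->
    p (inner (s%:C%C *: z + c *: u) (s%:C%C *: z + c *: u)) < e.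
  rewrite -scalerA => Bc; rewrite -sqr_mnorm // -[e]sqr_sqrtr ?ltW //.
  rewrite ltrXn2r ?nnegrE ?mnorm_ge0 ?ltW//.
  rewrite -[X in mnorm p (_ + X)]opprK -scaleNr.
  apply: (BB (_, _)); exists 0 => //=.
  exact: dB.
have -> : inner z (y' - y) = inner (s%:C%C *: z) u.
  rewrite innerZl innerZr scalerA.
  by rewrite /conjc /= oppr0 mulfV // scale1r.
have h1 := small 1 B1.
have hN1 := small (-1) BN1.
have hi := small 'i%C Bi.
have hNi := small (- 'i%C) BNi.
rewrite scale1r in h1; rewrite scaleN1r in hN1; rewrite scaleNr in hNi.
rewrite -(ltr_pM2l (ltr0n R 4)).
have <- : p (4 *: inner (s%:C%C *: z) u) = 4 * p (inner (s%:C%C *: z) u).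
  by rewrite (csnZ hp) normcMn Normc.normc1.
rewrite polarization.
apply: le_lt_trans (_ : _ + _ + _ + _ < _).
  by rewrite (le_trans (csnD hp _ _)) // lerD ?(le_trans (csnD hp _ _)) //
    lerD ?(le_trans (csnD hp _ _)).
have normi : ComplexField.Normc.normc 'i%C = 1 :> R.
  by rewrite /= expr0n expr1n add0r sqrtr1.
rewrite !csnN // !(csnZ hp) normi !mul1r.
have -> : 4 * e = e + e + e + e.
  by rewrite -mulr_natl !mulrSr mulr0n add0r !mulrDl !mul1r.
by rewrite !ltrD.
Qed.

End hilbert_topology.

(** * Adjointable maps *)

Section adjointable_maps.
Variables (R : realType) (B : proCStarType R) (G H : hilbertModType B).

(** Linearity over the scalars and over the algebra is forced by the existence
    of an adjoint, because vectors are separated by inner products. *)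
Lemma adjointable_of_adjoint (T : G -> H) (T' : H -> G) :
  (forall x y, inner (T x) y = inner x (T' y)) ->
  (forall p, cont_seminorms B p ->
    exists M, forall x, mnorm p (T x) <= M * mnorm p x) ->
  exists V : adjointable G H, V =1 T /\ adj V = T'.
Proof.
move=> TT' bT.
have T'T y x : inner y (T x) = inner (T' y) x.
  by rewrite -inner_star TT' inner_star.
have linT : linear T.
  by move=> c x y; apply: inner_inj => z; rewrite linearP /= !T'T linearP.
pose L := GRing.isLinear.Build R[i] G H *:%R T linT.
pose TL : {linear G -> H} := HB.pack T L.
have rT x b : TL (rmul x b) = rmul (TL x) b.
  by apply: inner_inj => z /=; rewrite inner_rmul !T'T inner_rmul.
by exists (Adjointable rT bT TT').
Qed.

Lemma adj_inner (T : adjointable G H) x y : inner y (T x) = inner (adj T y) x.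
Proof. by rewrite -inner_star adjP inner_star. Qed.

(** Adjoints are not assumed to be bounded; for a co-isometry the bound is
    automatic. *)
Lemma adj_coisometry_mnorm (W : adjointable G H) p y :
  (forall k, W (adj W k) = k) -> mnorm p (adj W y) = mnorm p y.
Proof. by move=> WW; rewrite /mnorm -adj_inner WW. Qed.

End adjointable_maps.

(** * Unitary extension of inner-product-preserving relations *)

Section relation_limit.
Variables (R : realType) (B : proCStarType R).

(** The closure of [S], with one filter converging in both coordinates so that
    equalities valid on [S] pass to the limit. *)
Definition rel_limit (G H : hilbertModType B) (S : set (G * H)) (x : G)
    (l : H) : Prop :=
  exists F : set_system (G * H),
    [/\ ProperFilter F, F S, fst @ F --> x & snd @ F --> l].

Definition inner_preserving (G H : hilbertModType B) (S : set (G * H)) :=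
  forall z w, S z -> S w -> inner z.1 w.1 = inner z.2 w.2.

Definition swap (G H : hilbertModType B) (S : set (G * H)) : set (H * G) :=
  [set z | S (z.2, z.1)].

Lemma rel_limit_swap (G H : hilbertModType B) (S : set (G * H)) x l :
  rel_limit (swap S) l x -> rel_limit S x l.
Proof.
move=> [F [FF FS Fl Fx]]; exists ((fun z => (z.2, z.1)) @ F).
by split; [exact: fmap_proper_filter|exact: FS|exact: Fx|exact: Fl].
Qed.

Lemma inner_preserving_swap (G H : hilbertModType B) (S : set (G * H)) :
  inner_preserving S -> inner_preserving (swap S).
Proof. by move=> Sp z w Sz Sw; rewrite (Sp (z.2, z.1) (w.2, w.1)). Qed.

Variables (G H : hilbertModType B) (S : set (G * H)).
Hypothesis Sip : inner_preserving S.

Lemma inner_preserving_mnorm p z w : S z -> S w ->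
  mnorm p (z.1 - w.1) = mnorm p (z.2 - w.2).
Proof.
by move=> Sz Sw; rewrite /mnorm !linearB /= !innerBl /= !Sip.
Qed.

Lemma sub_rel_limit : S `<=` [set z | rel_limit S z.1 z.2].
Proof.
move=> z Sz; have FF := principal_filter_proper z.
exists (principal_filter z); split=> //; first exact/principal_filterP.
- by move=> A /nbhs_singleton Az; apply/principal_filterP.
- by move=> A /nbhs_singleton Az; apply/principal_filterP.
Qed.

(** Separate continuity of the inner product suffices: the limit is taken in
    one pair at a time. *)
Lemma rel_limit_inner x l x' l' : rel_limit S x l -> rel_limit S x' l' ->
  inner x x' = inner l l'.
Proof.
have pass u v y m : (forall z, S z -> inner u z.1 = inner v z.2) ->
    rel_limit S y m -> inner u y = inner v m.
  move=> uv [F [FF FS Fy Fm]].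
  have c1 : (fun w : G * H => inner u w.1) @ F --> inner u y.
    exact: (cvg_comp _ _ Fy (@inner_continuous _ _ _ u y)).
  have c2 : (fun w : G * H => inner v w.2) @ F --> inner v m.
    exact: (cvg_comp _ _ Fm (@inner_continuous _ _ _ v m)).
  apply: (cvg_unique (@procstar_hausdorff R B) c1).
  apply: cvg_trans c2; apply: near_eq_cvg.
  by apply: filterS FS => w Sw; rewrite uv.
move=> xl xl'; apply: (pass) xl' => z Sz.
rewrite -[LHS]inner_star -[RHS]inner_star; congr star.
by apply: (pass) xl => w Sw; rewrite Sip.
Qed.

Hypothesis Sdense : closure (fst @` S) = setT.

(** A filter on [S] that converges in the first coordinate is Cauchy in the
    second, because [S] preserves the seminorms of differences. *)
Lemma rel_limit_exists x : exists l, rel_limit S x l.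
Proof.
pose F : set_system (G * H) :=
  filter_from (nbhs x) (fun N => [set z | S z /\ N z.1]).
have FF : ProperFilter F.
  apply: filter_from_proper.
    apply: filter_from_filter; first by exists setT; exact: filterT.
    move=> M N nM nN; exists (M `&` N); first exact: filterI.
    by move=> z [Sz [Mz Nz]].
  move=> N nN; have : closure (fst @` S) x by rewrite Sdense.
  by move=> /(_ _ nN) [_ [[z Sz <-] Nz]]; exists z.
have FS : F S by exists setT; [exact: filterT|move=> z []].
have Fx : fst @ F --> x by move=> N nN; exists N => // z [].
have [l Fl] : exists l : H, snd @ F --> l.
  apply: hilbert_complete.
  rewrite /cauchy /cvg_to nbhs_simpl.
  apply: hilbert_entourage_sub => p e Sp e0.
  have Ue := mnorm_entourage G Sp e0.
  move: (entourage_invI (entourage_split_ent Ue)).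
  set V := (_ `&` _)%classic => sU.
  pose Z := [set z : G * H | S z /\ xsection V x z.1].
  have FZ : F Z by exists (xsection V x); first exact: nbhs_entourage.
  exists (snd @` Z, snd @` Z) => /=.
    by split; apply: filterS FZ => z Zz; exists z.
  move=> [_ _] [/= [z [Sz /xsectionP[_ zx]] <-]
    [w [Sw /xsectionP[xw _]] <-]].
  rewrite -inner_preserving_mnorm //.
  exact: (entourage_split x Ue zx xw).
by exists l, F.
Qed.

End relation_limit.

Section unitary_extension.
Variables (R : realType) (B : proCStarType R) (G H : hilbertModType B).

(** The limits of the pairs of [S] form the graph of a unitary: they exist
    over every vector of [G] and [H], and still preserve inner products, so
    that the two maps they define are single-valued, adjoint, and inverse to
    each other. *)
Lemma unitary_extension (S : set (G * H)) : inner_preserving S ->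
  closure (fst @` S) = setT -> closure (snd @` S) = setT ->
  exists (U : G -> H) (U' : H -> G),
    [/\ forall x y, inner (U x) y = inner x (U' y),
        cancel U U', cancel U' U & forall z, S z -> U z.1 = z.2].
Proof.
move=> Sip dG dH.
have sip := inner_preserving_swap Sip.
have dH' : closure (fst @` swap S) = setT.
  rewrite -dH; congr closure; rewrite eqEsubset.
  by split=> y [[u v] Suv <-]; exists (v, u).
have [U US] := choice (rel_limit_exists Sip dG).
have [U' US'] := choice (rel_limit_exists sip dH').
have US'' y : rel_limit S (U' y) y by apply: rel_limit_swap; exact: US'.
have functional x l m : rel_limit S x l -> rel_limit S x m -> l = m.
  move=> xl xm; apply: inner_sqr_eq.
    by rewrite -(rel_limit_inner Sip xl xl) -(rel_limit_inner Sip xl xm).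
  by rewrite -(rel_limit_inner Sip xm xl) -(rel_limit_inner Sip xm xm).
have cofunctional x y l : rel_limit S x l -> rel_limit S y l -> x = y.
  move=> xl yl; apply: inner_sqr_eq.
    by rewrite (rel_limit_inner Sip xl xl) (rel_limit_inner Sip xl yl).
  by rewrite (rel_limit_inner Sip yl xl) (rel_limit_inner Sip yl yl).
exists U, U'; split.
- by move=> x y; rewrite (rel_limit_inner Sip (US x) (US'' y)).
- by move=> x; exact: cofunctional (US'' (U x)) (US x).
- by move=> y; exact: functional (US (U' y)) (US'' y).
- by move=> z Sz; exact: functional (US z.1) (sub_rel_limit Sz).
Qed.

End unitary_extension.

Section generators.
Variables (R : realType) (B : proCStarType R).

Definition span_pairs (I : Type) (G H : hilbertModType B) (g : I -> G)
    (h : I -> H) : set (G * H) :=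
  [set z | exists (n : nat) (c : 'I_n -> R[i]) (s : 'I_n -> I),
     z.1 = \sum_(i < n) c i *: g (s i) /\ z.2 = \sum_(i < n) c i *: h (s i)].

Lemma span_pairs_inner (I : Type) (G H : hilbertModType B) (g : I -> G)
    (h : I -> H) :
  (forall i j, inner (g i) (g j) = inner (h i) (h j)) ->
  inner_preserving (span_pairs g h).
Proof.
move=> gh [_ _] [_ _] [/= n [c [s [-> ->]]]] [/= m [d [t [-> ->]]]].
rewrite !inner_suml; apply: eq_bigr => i _; rewrite !linear_sum.
by apply: eq_bigr => j _; rewrite !linearZ /= !innerZl gh.
Qed.

Lemma unitary_of_generators (I : Type) (G H : hilbertModType B) (g : I -> G)
    (h : I -> H) :
  (forall i j, inner (g i) (g j) = inner (h i) (h j)) ->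
  closure (lspan (range g)) = setT -> closure (lspan (range h)) = setT ->
  exists (U : G -> H) (U' : H -> G),
    [/\ forall x y, inner (U x) y = inner x (U' y),
        cancel U U', cancel U' U & forall i, U (g i) = h i].
Proof.
move=> gh dg dh.
have lspan_range (K : hilbertModType B) (f : I -> K) v :
    lspan (range f) v -> exists n (c : 'I_n -> R[i]) (s : 'I_n -> I),
      v = \sum_(i < n) c i *: f (s i).
  move=> [n [c [w [/= fw ->]]]].
  have /choice[s ws] i : exists t, w i = f t.
    by have [t _ <-] := fw i; exists t.
  by exists n, c, s; apply: eq_bigr => i _; rewrite ws.
have d1 : closure (fst @` span_pairs g h) = setT.
  apply/seteqP; split=> //; rewrite -dg.
  apply: closureS => _ /lspan_range[n [c [s ->]]].
  by exists (\sum_(i < n) c i *: g (s i), \sum_(i < n) c i *: h (s i)) => //;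
    exists n, c, s.
have d2 : closure (snd @` span_pairs g h) = setT.
  apply/seteqP; split=> //; rewrite -dh.
  apply: closureS => _ /lspan_range[n [c [s ->]]].
  by exists (\sum_(i < n) c i *: g (s i), \sum_(i < n) c i *: h (s i)) => //;
    exists n, c, s.
have [U [U' [UU' UK U'K Ugh]]] :=
  unitary_extension (span_pairs_inner gh) d1 d2.
exists U, U'; split=> // i.
apply: (Ugh (g i, h i)).
exists 1%N, (fun=> 1), (fun=> i).
by rewrite !big_ord1 !scale1r.
Qed.

End generators.

(** * Comparison of Stinespring constructions *)

Section associated_map.
Variables (R : realType) (A B : proCStarType R) (E : hilbertModType A).

(** Polarization gives equality on all inner products, and fullness together
    with continuity extends it to the whole algebra. *)
Lemma associated_map_unique (F : hilbertModType B) (phi psi : {linear A -> B})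
    (Phi Psi : E -> F) : full E -> cp_map phi Phi -> cp_map psi Psi ->
  equiv_map Phi Psi -> phi =1 psi.
Proof.
move=> fE [cphi _ hPhi] [cpsi _ hPsi] PP a.
have diag (x : E) : phi (inner x x) = psi (inner x x).
  by rewrite -(hPhi x x) -(hPsi x x) PP.
have lin4 (f : {linear A -> B}) (b c d e : A) :
    f (b - c - 'i%C *: d + 'i%C *: e) = f b - f c - 'i%C *: f d + 'i%C *: f e.
  by rewrite linearD !linearB !linearZ.
have offdiag (x y : E) : phi (inner x y) = psi (inner x y).
  have /(congr1 (fun v => 4%:R^-1 *: v)) :
      4%:R *: phi (inner x y) = 4%:R *: psi (inner x y).
    rewrite -[LHS]linearZ -[RHS]linearZ polarization.
    by rewrite !lin4 !diag.
  by rewrite !scalerA mulVf ?pnatr_eq0 // !scale1r.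
have spans v : lspan [set inner x y | x in @setT E & y in @setT E] v ->
    phi v = psi v.
  move=> [n [c [s [hs ->]]]]; rewrite !linear_sum; apply: eq_bigr => i _.
  by rewrite !linearZ; have [x _ [y _ <-]] := hs i; rewrite /= offdiag.
have : closure (lspan [set inner x y | x in @setT E & y in @setT E]) a.
  by rewrite fE.
move=> cl; apply: (@procstar_hausdorff R B) => M N nM nN.
have nMa : nbhs a (phi @^-1` M) := cphi a _ nM.
have nNa : nbhs a (psi @^-1` N) := cpsi a _ nN.
have [v [Sv [Mv Nv]]] := cl _ (filterI nMa nNa).
by exists (phi v); split=> //; rewrite (spans v Sv).
Qed.

End associated_map.

Section comparison.
Variables (R : realType) (A B : proCStarType R) (E : hilbertModType A).
Variables (F : hilbertBimodType B) (D : hilbertBimodType B) (d0 : D).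

(** The inner products of the generators of [K_Phi] depend only on [phi] and
    [D], not on the construction. *)
Lemma stinespring_inner (phi : {linear A -> B}) (Phi : E -> F)
    (s : stinespring d0 phi Phi) x y d e :
  inner (st_pi s x (st_V s d)) (st_pi s y (st_V s e)) =
  inner d (lact (phi (inner x y)) e).
Proof. by rewrite adjP st_pi_inner adjP -st_phi. Qed.

Lemma stinespring_unitary (phi psi : {linear A -> B}) (Phi Psi : E -> F)
    (s : stinespring d0 phi Phi) (t : stinespring d0 psi Psi) :
  phi =1 psi ->
  exists (U : st_KPhi s -> st_KPhi t) (U' : st_KPhi t -> st_KPhi s),
    [/\ forall x y, inner (U x) y = inner x (U' y),
        cancel U U', cancel U' U &
        forall x d, U (st_pi s x (st_V s d)) = st_pi t x (st_V t d)].
Proof.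
move=> pp.
pose g i := st_pi s i.1 (st_V s i.2); pose h i := st_pi t i.1 (st_V t i.2).
have gh i j : inner (g i) (g j) = inner (h i) (h j).
  by rewrite !stinespring_inner pp.
have rangeE (K : Type) (f : E -> D -> K) :
    range (fun i => f i.1 i.2) = [set f x d | x in setT & d in setT].
  apply/seteqP; split=> [_ [[x d] _ <-]|_ [x _ [d _ <-]]].
    by exists x => //; exists d.
  by exists (x, d).
have [||U [U' [UU' c c' Ug]]] := unitary_of_generators gh.
- by rewrite (rangeE _ (fun x d => st_pi s x (st_V s d))) st_minimal_Phi.
- by rewrite (rangeE _ (fun x d => st_pi t x (st_V t d))) st_minimal_Phi.
by exists U, U'; split=> // x d; exact: (Ug (x, d)).
Qed.

Lemma range_projection (phi : {linear A -> B}) (Phi : E -> F)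
    (s : stinespring d0 phi Phi) x :
  adj (st_W s) (st_W s (Phi x)) = Phi x.
Proof. by rewrite (st_Phi s) st_coisometry. Qed.

End comparison.

Theorem proposition3p3 (R : realType) (A B : proCStarType R)
    (E : hilbertModType A) (hE : full E) (F : hilbertBimodType B)
    (phi psi : {linear A -> B}) (Phi Psi : E -> F)
    (hPhi : cp_map phi Phi) (hPsi : cp_map psi Psi)
    (D : hilbertBimodType B) (d0 : D)
    (sPhi : stinespring d0 phi Phi) (sPsi : stinespring d0 psi Psi) :
  equiv_map Phi Psi <->
  exists V : adjointable F F,
    [/\ partial_isometry V,
        (forall y : F, V (adj V y) = adj (st_W sPhi) (st_W sPhi y)) /\
        (forall y : F, adj V (V y) = adj (st_W sPsi) (st_W sPsi y))
      & forall x : E, Phi x = V (Psi x)].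
Proof.
split=> [PP|[V [_ [_ V'V] PV]] x]; last first.
  (* [V^* V] is the projection that fixes [Psi x]. *)
  by rewrite PV adjP V'V range_projection.
have [U [U' [UU' UK U'K Upi]]] :=
  stinespring_unitary sPhi sPsi (associated_map_unique hE hPhi hPsi PP).
pose T y := adj (st_W sPhi) (U' (st_W sPsi y)).
pose T' y := adj (st_W sPsi) (U (st_W sPhi y)).
have TT' x y : inner (T x) y = inner x (T' y).
  by rewrite -adj_inner -adjP -[LHS]inner_star -UU' inner_star.
have bT p : cont_seminorms B p ->
    exists M, forall x, mnorm p (T x) <= M * mnorm p x.
  move=> Sp; have [M bM] := op_bounded (st_W sPsi) Sp; exists M => x.
  rewrite adj_coisometry_mnorm; last exact: st_coisometry.
  by apply: le_trans (bM x); rewrite /mnorm -UU' U'K.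
have [V [VE V'E]] := adjointable_of_adjoint TT' bT.
exists V; rewrite V'E; split.
- by move=> x; rewrite V'E !VE /T /T' !st_coisometry UK.
- split=> y; rewrite VE /T /T' st_coisometry; first by rewrite UK.
  by rewrite U'K.
- move=> x; rewrite VE /T (st_Phi sPsi) st_coisometry -Upi UK.
  exact: st_Phi.
Qed.
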